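(* Let $d\ge2$, let $Q\in l_1(\mathbb{Z})$ be a strictly positive even function (symmetric transfer operator of a gradient interaction potential), and let $\lambda_{q_1}$ and $\lambda_{q_2}$ be two spatially homogeneous height-periodic boundary laws for $Q$ with minimal periods $q_1$ and $q_2$, respectively. If the associated gradient Gibbs measures satisfy $\nu^{\lambda_{q_1}}=\nu^{\lambda_{q_2}}$, then $q_1=q_2$ and there exist a cyclic permutation $\rho$ of $\mathbb{Z}_{q_1}$ (i.e. $\rho(\bar k)=\bar k+\bar a$ for some $\bar a\in\mathbb{Z}_{q_1}$) and a constant $c>0$ such that $\lambda_{q_2}=c\,\lambda_{q_1}\circ\rho$.
   Context: The Cayley tree $\Gamma^d=(V,L)$ of order $d$ is the infinite connected graph without cycles in which every vertex has exactly $d+1$ neighbours; $\vec L$ denotes the set of oriented edges. Periodic boundary laws. A (spatially homogeneous) $q$-periodic boundary law for $Q$ is a $q$-periodic function $\lambda_q:\mathbb{Z}\to(0,\infty)$ for which there is $c>0$ with $\lambda_q(i)=c\big(\sum_{j\in\mathbb{Z}}Q(i-j)\lambda_q(j)\big)^d$ for all $i\in\mathbb{Z}$; it is identified with a function on $\mathbb{Z}_q=\mathbb{Z}/q\mathbb{Z}$. Put $Q_q(\bar s)=\sum_{l\in\bar s}Q(l)$ for $\bar s\in\mathbb{Z}_q$. The gradient Gibbs measure $\nu^{\lambda_q}$. Gradient configurations are $\zeta\in\mathbb{Z}^{\vec L}$ with $\zeta_{(x,y)}=-\zeta_{(y,x)}$. Let $P'_q(\bar i,\bar j)=\frac{Q_q(\bar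 i-\bar j)\lambda_q(\bar j)}{\sum_{\bar s\in\mathbb{Z}_q}Q_q(\bar i-\bar s)\lambda_q(\bar s)}$, a transition matrix on $\mathbb{Z}_q$ with reversible stationary distribution $\alpha(\bar i)=\lambda_q(\bar i)^{\frac{d+1}{d}}/\sum_{\bar j\in\mathbb{Z}_q}\lambda_q(\bar j)^{\frac{d+1}{d}}$. Let $P^{\lambda_q,\mathrm{f.c.}}$ be the law on $\mathbb{Z}_q^V$ of the stationary tree-indexed Markov chain $\sigma'$: for finite connected $\Lambda\ni w$, $P^{\lambda_q,\mathrm{f.c.}}(\sigma'_\Lambda)=\alpha(\sigma'_w)\prod P'_q(\sigma'_x,\sigma'_y)$, the product over edges $(x,y)$ in $\Lambda$ oriented away from $w$. Let $\rho^Q_q(j\mid\bar s)=\mathbf 1(j\in\bar s)\,Q(j)/Q_q(\bar s)$. Then $\nu^{\lambda_q}$ is the probability measure on gradient configurations $\eta$ with marginals, for finite connected $\Lambda\subset V$, $$\nu^{\lambda_q}(\eta_\Lambda=\zeta_\Lambda)=\sum_{\sigma'_\Lambda\in\mathbb{Z}_q^\Lambda}P^{\lambda_q,\mathrm{f.c.}}(\sigma'_\Lambda)\prod_{(x,y)}\rho^Q_q(\zeta_{(x,y)}\mid\sigma'_y-\sigma'_x),$$ the product over the edges inside $\Lambda$, each taken in one orientation. (For $q=1$ this is the free state with i.i.d. increments.) *)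

(* Defs.v *)
From HB Require Import structures.
From mathcomp Require Import all_boot all_order all_algebra finmap.
From mathcomp Require Import all_classical all_reals all_analysis.

Set Implicit Arguments.
Unset Strict Implicit.
Unset Printing Implicit Defensive.

Import Order.TTheory GRing.Theory Num.Theory.

Local Open Scope classical_set_scope.
Local Open Scope ring_scope.

(* These conditions determine the graph (V, adj) up to isomorphism.
   [ucycle adj [:: x; y]] holds for every edge, whence the bound on the size
   in the acyclicity clause. *)
Definition cayley_tree (d : nat) (V : choiceType) (adj : rel V) : Prop :=
  [/\ infinite_set [set: V],
      symmetric adj /\ irreflexive adj,
      (forall x y : V, exists2 p : seq V, path adj x p & last x p = y),
      (forall c : seq V, (2 < size c)%N -> ~ ucycle adj c)
    & (forall x : V, exists2 N : {fset V}, #|` N| = d.+1 &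
         forall y : V, adj x y = (y \in N))].

(* Integer-valued antisymmetric functions on oriented edges, encoded as
   functions of two vertices that vanish on pairs which are not edges. *)
Record gradient (V : choiceType) (adj : rel V) := Gradient {
  increment :> V -> V -> int;
  increment_anti : forall x y : V, increment x y = - increment y x;
  increment_off_edges : forall x y : V, ~~ adj x y -> increment x y = 0 }.

Section gradient_space.
Variables (V : choiceType) (adj : rel V).

HB.instance Definition _ := gen_eqMixin (gradient adj).
HB.instance Definition _ := gen_choiceMixin (gradient adj).

Definition gradient0 : gradient adj :=
  @Gradient V adj (fun _ _ => 0) (fun _ _ => esym (oppr0 _)) (fun _ _ _ => erefl).

HB.instance Definition _ := isPointed.Build (gradient adj) gradient0.

Definition gradient_events : set (set (gradient adj)) :=
  [set A | exists x y : V, exists k : int,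
     adj x y /\ A = [set eta : gradient adj | eta x y = k]].

(* Gradient configurations with the product sigma-algebra. *)
Definition gradient_space := g_sigma_algebraType gradient_events.

Definition connected_in (L : {fset V}) : Prop :=
  forall x y : L, connect [rel u v : L | adj (val u) (val v)] x y.

(* In a tree: (x, y) is the last edge of the self-avoiding path from w to y,
   i.e. (x, y) is an edge oriented away from w. *)
Definition away_from (w x y : V) : Prop :=
  exists p : seq V,
    [/\ path adj w (rcons p y), uniq (w :: rcons p y) & last w p = x].

End gradient_space.

Section boundary_laws.
Variables (R : realType) (d : nat) (Q : int -> R).

Definition periodic (q : nat) (lam : int -> R) : Prop :=
  forall i : int, lam (i + q%:Z) = lam i.

Definition minimal_period (q : nat) (lam : int -> R) : Prop :=
  [/\ (0 < q)%N, periodic q lam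
    & forall p : nat, (0 < p)%N -> periodic p lam -> (q <= p)%N].

Definition periodic_boundary_law (q : nat) (lam : int -> R) : Prop :=
  [/\ (0 < q)%N, (forall i : int, 0 < lam i), periodic q lam
    & exists2 c : R, 0 < c & forall i : int,
        ((lam i)%:E =
         c%:E * (\esum_(j in [set: int]) (Q (i - j) * lam j)%:E) ^+ d)%E].

(* From here on a function on Z/qZ is a function on int that only depends on
   its argument modulo q, and a Z/qZ-valued spin is represented by its residue
   in 'I_q (the types 'Z_q are not used since 'Z_1 has two elements). *)

Definition Qq (q : nat) (s : int) : R :=
  fine (\esum_(l in [set l : int | (l = s %[mod q%:Z])%Z]) (Q l)%:E).

Variables (q : nat) (lam : int -> R).

Definition transition (i j : int) : R :=
  Qq q (i - j) * lam j / \sum_(s < q) Qq q (i - s%:Z) * lam s%:Z.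

Definition stationary (i : int) : R :=
  lam i `^ (d.+1%:R / d%:R) / \sum_(j < q) lam j%:Z `^ (d.+1%:R / d%:R).

Definition increment_law (j s : int) : R :=
  if (j == s %[mod q%:Z])%Z then Q j / Qq q s else 0.

Variables (V : choiceType) (adj : rel V).

Definition fuzzy_marginal (L : {fset V}) (w : L) (sigma : {ffun L -> 'I_q}) : R :=
  stationary (sigma w)%:Z *
  \prod_(e : L * L | `[< away_from adj (val w) (val e.1) (val e.2) >])
    transition (sigma e.1)%:Z (sigma e.2)%:Z.

Definition gradient_marginal (L : {fset V}) (w : L) (zeta : gradient adj) : R :=
  \sum_(sigma : {ffun L -> 'I_q})
    fuzzy_marginal w sigma *
    \prod_(e : L * L | `[< away_from adj (val w) (val e.1) (val e.2) >])
      increment_law (zeta (val e.1) (val e.2))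
                    ((sigma e.2)%:Z - (sigma e.1)%:Z).

(* A configuration on the edges inside L is given as the restriction of a
   configuration zeta on the whole tree.  These marginals are consistent and
   their cylinders are a generating pi-system, so nu is unique. *)
Definition gradient_gibbs_measure
    (nu : probability (gradient_space adj) R) : Prop :=
  forall (L : {fset V}) (w : L) (zeta : gradient adj),
    connected_in adj L ->
    nu [set eta : gradient adj | forall x y : L, adj (val x) (val y) ->
          eta (val x) (val y) = zeta (val x) (val y)]
    = (gradient_marginal w zeta)%:E.

End boundary_laws.

(* Main.v *)
Require Import Defs.
From mathcomp Require Import all_boot all_order all_algebra finmap.
From mathcomp Require Import all_classical all_reals all_analysis.
From mathcomp Require Import ring.

Set Implicit Arguments.
Unset Strict Implicit.
Unset Printing Implicit Defensive.

Import Order.TTheory GRing.Theory Num.Theory.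
Local Open Scope classical_set_scope.
Local Open Scope ring_scope.

(** A gradient Gibbs measure is tested only on self-avoiding paths of the
    tree, with the heights along the path prescribed.

    Write [S i] for the sum over the spins [s] of [Qq (i - s) * lam s]
    ([fuzzy_norm]), the denominator of the transition matrix.  On a path with
    vertices [x_0], ..., [x_m] and heights [H_0 = 0], [H_1], ..., [H_m], the
    increments are compatible with exactly [q] fuzzy configurations, namely the
    residues of [k + H_i] for [k < q].  The weights [Qq] of the transition matrix
    cancel against the denominators of the increment law, because [Qq] is even.
    Hence ([path_marginal]) the probability of the prescribed increments is a
    product of values of [Q], which is the same for both laws, times
      sum over [k] of [alpha k * \prod_i (lam (k + H_(i+1)) / S (k + H_i))].
    If [H_m = 0] too, the product can be regrouped by vertices: with
    [g = lam / S] ([law_ratio]) it is [g k] times the product of the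
    [g (k + H_i)] over the interior vertices ([height_path_marginal]).

    Since paths can be arbitrarily long and the interior heights are arbitrary,
    equality of the two measures says that the positive measures on functions
    [int -> R] that charge the translates of [g1], respectively of [g2], have
    the same mixed moments.  Finitely many points are determined by such moments
    ([moments_determine_points]), so [g2] is a translate of [g1].

    The boundary law equation reads [lam = c * S ^+ d], whence
    [g ^+ d = c * lam ^+ d.-1].  As [d >= 2], [lam] is recovered from [g] up to
    a constant factor; so [lam2] is a multiple of a translate of [lam1], and the
    minimal periods coincide. *)

(** * Self-avoiding paths in a tree *)

Section simple_paths.
Variables (V : choiceType) (adj : rel V).
Hypothesis adj_sym : symmetric adj.
Hypothesis adj_acyclic : forall c : seq V, (2 < size c)%N -> ~ ucycle adj c.

(** At the first step where two self-avoiding paths from [x] differ, the two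
    continuations meet again away from [x]; joining them and removing loops
    yields a cycle through [x]. *)
Lemma simple_path_unique (x : V) (p p' : seq V) :
  path adj x p -> uniq (x :: p) -> path adj x p' -> uniq (x :: p') ->
  last x p = last x p' -> p = p'.
Proof.
elim: p x p' => [|a p IH] x [|b p'] //=.
- by move=> _ _ _ /andP[xp' _] /= xE; rewrite xE mem_last in xp'.
- by move=> _ /andP[xp _] _ _ /= xE; rewrite -xE mem_last in xp.
move=> /andP[xa pap] /andP[xap uap] /andP[xb pbp'] /andP[xbp' ubp'] lastE.
have [ab|ab] := eqVneq a b.
  by subst b; congr (_ :: _); apply: (IH a).
pose w := p ++ rev (belast b p').
have paw : path adj a w.
  rewrite cat_path pap lastE rev_path.
  by rewrite (@eq_path _ _ adj) // => u v; rewrite adj_sym.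
have law : last a w = b.
  by rewrite last_cat lastE; case: (p') => //= c r; rewrite rev_cons last_rcons.
have xw : x \notin a :: w.
  rewrite -cat_cons mem_cat negb_or xap mem_rev /=.
  by apply: contra xbp' => /mem_belast.
move: law; case/shortenP: paw => r par uar rw lar.
case: (@adj_acyclic [:: x, a & r]).
  by case: r {par uar rw} lar => //= aE; rewrite aE eqxx in ab.
apply/andP; split.
  by rewrite /= rcons_path xa par lar adj_sym.
rewrite cons_uniq uar andbT.
apply: contra xw; rewrite !inE => /orP[->//|/rw ->]; exact: orbT.
Qed.

(** Paths are extended at their head: a new neighbour [z] of the head, other
    than the second vertex, cannot lie on the path without closing a cycle. *)
Lemma simple_path_extension (x z : V) (p : seq V) :
  irreflexive adj -> path adj x p -> uniq (x :: p) -> adj x z -> z != head x p ->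
  path adj z (x :: p) /\ uniq [:: z, x & p].
Proof.
move=> irr pxp uxp xz zh; split; first by rewrite /= adj_sym xz.
rewrite cons_uniq uxp andbT inE negb_or; apply/andP; split.
  by apply: contraTneq xz => ->; rewrite irr.
case: p pxp uxp zh => [|y p] //= /andP[xy pyp] uxyp zy.
rewrite inE negb_or zy /=; apply/negP => zp.
move: pyp uxyp; case/splitPr: zp => p1 p2; rewrite -cat_rcons => pyp uxyp.
case: (@adj_acyclic [:: x, y & rcons p1 z]); first by rewrite /= size_rcons.
apply/andP; split.
  rewrite /= rcons_path xy /= last_rcons adj_sym xz andbT.
  by move: pyp; rewrite cat_path => /andP[].
have : uniq ([:: x, y & rcons p1 z] ++ p2) by exact: uxyp.
by rewrite cat_uniq => /and3P[].
Qed.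

(** By uniqueness of self-avoiding paths, the edges that point away from an
    endpoint of a path are its consecutive pairs in order; in particular no edge
    occurs in both orientations. *)
Lemma away_from_path (x a b : V) (p : seq V) :
  path adj x p -> uniq (x :: p) -> b \in x :: p ->
  away_from adj x a b <->
  exists2 i, (i < size p)%N & a = nth x (x :: p) i /\ b = nth x (x :: p) i.+1.
Proof.
move=> pxp uxp bp; split.
  move=> [r [pr ur lr]].
  have bx : b != x.
    by apply: contraTneq ur => ->; rewrite /= mem_rcons mem_head.
  move: bp; rewrite inE (negPf bx) /= => bp.
  move: pxp uxp; case/splitPr: bp => p1 p2 pxp uxp.
  have rE : rcons r b = rcons p1 b.
    apply: (@simple_path_unique x) => //; rewrite ?last_rcons//.
    - by move: pxp; rewrite -cat_rcons cat_path => /andP[].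
    - by move: uxp; rewrite -cat_rcons -cat_cons cat_uniq => /and3P[].
  move: rE => /rcons_inj[rE]; exists (size p1).
    by rewrite size_cat /= addnS ltnS leq_addr.
  rewrite -lr rE; split; last by rewrite /= nth_cat ltnn subnn.
  by rewrite -cat_cons nth_cat /= ltnSn -last_nth.
move=> [i ip [-> bE]]; exists (take i p).
rewrite bE /= -take_nth //; split.
- exact: take_path.
- by move: uxp => /(take_uniq i.+2).
- by rewrite (last_nth x) size_take ip -/(take i.+1 (x :: p)) nth_take.
Qed.

End simple_paths.

Lemma tree_has_long_path (d : nat) (V : choiceType) (adj : rel V) (n : nat) :
  (0 < d)%N -> cayley_tree d adj ->
  exists (x : V) (p : seq V), [/\ path adj x p, uniq (x :: p) & size p = n].
Proof.
move=> d0 [infV [sym irr] _ acy nbh]; elim: n => [|n [x [p [pxp uxp sp]]]].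
  have /set0P[x _] : [set: V] != set0.
    by apply/eqP => V0; apply: infV; rewrite V0.
  by exists x, [::].
have [N cN xN] := nbh x.
have /fset0Pn[z] : (N `\ head x p)%fset != fset0.
  rewrite -cardfs_gt0; have := cardfsD1 (head x p) N; rewrite cN.
  by case: (_ \in _); rewrite ?add1n ?add0n; [move=> [<-]|move=> <-].
rewrite in_fsetD1 -xN => /andP[zh xz].
have [pz uz] := simple_path_extension sym acy irr pxp uxp xz zh.
by exists z, (x :: p); rewrite pz uz /= sp.
Qed.

(** * Points determined by their moments *)

(** If [g j] differed from every [f i], say at the coordinate [t i], then the
    square of the product of the affine functions
    [fun h => h (t i) - f i (t i)] would vanish at all the points [f i] and be
    positive at [g j].  The moments give equal integrals of this polynomial
    against [v] and [w], which is impossible since [w] is positive. *)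
Lemma moments_determine_points (R : realFieldType) (I J : finType) (T : Type)
    (v : I -> R) (w : J -> R) (f : I -> T -> R) (g : J -> T -> R) :
  (forall j, 0 < w j) ->
  (forall s : seq T, \sum_i v i * \prod_(t <- s) f i t =
                     \sum_j w j * \prod_(t <- s) g j t) ->
  forall j, exists i, f i =1 g j.
Proof.
move=> w0 moments j; apply: contrapT => nj.
have {}nj i : exists t, f i t != g j t.
  apply: contrapT => ni; apply: nj; exists i => t.
  by apply/eqP; apply: contrapT => /negP ?; apply: ni; exists t.
have [t tP] := choice nj.
(* Multiplying out one affine factor at a time reduces an integral with affine
   factors to pure moments. *)
have factors (l : seq (T * R)) (s : seq T) :
    \sum_i v i * ((\prod_(t <- s) f i t) * \prod_(c <- l) (f i c.1 - c.2)) =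
    \sum_j w j * ((\prod_(t <- s) g j t) * \prod_(c <- l) (g j c.1 - c.2)).
  elim: l s => [|c l IH] s.
    under eq_bigr do rewrite big_nil mulr1.
    by under [RHS]eq_bigr do rewrite big_nil mulr1.
  have expand (K : finType) (u : K -> R) (h : K -> T -> R) :
      \sum_k u k * ((\prod_(t <- s) h k t) * \prod_(c <- c :: l) (h k c.1 - c.2)) =
      \sum_k u k * ((\prod_(t <- c.1 :: s) h k t) * \prod_(c <- l) (h k c.1 - c.2))
      - c.2 * \sum_k u k * ((\prod_(t <- s) h k t) * \prod_(c <- l) (h k c.1 - c.2)).
    rewrite mulr_sumr -sumrB; apply: eq_bigr => k _.
    by rewrite !big_cons; ring.
  by rewrite !expand !IH.
pose l := [seq (t i, f i (t i)) | i <- index_enum I].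
have := factors (l ++ l) [::].
rewrite big1 => [|i _]; last first.
  rewrite big_nil mul1r big_cat /= big_map (bigD1 i) //= subrr.
  by rewrite !mul0r mulr0.
move/esym/eqP; rewrite psumr_eq0 => [|k _]; last first.
  by rewrite big_nil mul1r big_cat /= mulr_ge0 ?(ltW (w0 _))// -expr2 sqr_ge0.
move=> /allP/(_ j (mem_index_enum _)); apply/negP; rewrite /=.
have l_neq0 : \prod_(c <- l) (g j c.1 - c.2) != 0.
  rewrite big_map prodf_seq_neq0; apply/allP => i _ /=.
  by rewrite subr_eq0 eq_sym tP.
by rewrite big_nil mul1r big_cat /= !mulf_eq0 (negPf l_neq0) gt_eqF.
Qed.

(** * Functions of residues *)

Section residues.
Variables (q : nat) (q_gt0 : (0 < q)%N).

Lemma residue_subproof (j : int) : (`|(j %% q%:Z)%Z|%N < q)%N.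
Proof.
rewrite -ltz_nat gez0_abs ?modz_ge0 ?ltz_pmod//.
by rewrite eqz_nat -lt0n.
Qed.

Definition residue (j : int) : 'I_q := Ordinal (residue_subproof j).

Lemma residue_mod (j : int) : (residue j)%:Z = (j %% q%:Z)%Z.
Proof. by rewrite /= gez0_abs ?modz_ge0// eqz_nat -lt0n. Qed.

Lemma residue_eq (j : int) (s : 'I_q) : (j = s%:Z %[mod q%:Z])%Z -> residue j = s.
Proof.
move=> js; apply: val_inj => /=.
by rewrite js modz_nat modn_small ?absz_nat.
Qed.

Lemma residue_id (s : 'I_q) : residue s%:Z = s.
Proof. exact: residue_eq. Qed.

Lemma periodic_mod (R : realType) (lam : int -> R) (i j : int) :
  Defs.periodic q lam -> (i = j %[mod q%:Z])%Z -> lam i = lam j.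
Proof.
move=> per ij.
have shift (k : int) (n : nat) : lam (k + n%:Z * q%:Z) = lam k.
  elim: n => [|n IH]; first by rewrite mul0r addr0.
  by rewrite intS mulrDl mul1r [X in _ + X]addrC addrA per.
have {}shift (k n : int) : lam (k + n * q%:Z) = lam k.
  case: n => n; first exact: shift.
  by rewrite NegzE mulNr -[RHS](shift _ n.+1) -(shift _ n.+1) subrK.
have /dvdzP[n nE] : (q%:Z %| i - j)%Z by rewrite -eqz_mod_dvd; apply/eqP.
by rewrite -(subrK j i) nE addrC shift.
Qed.

End residues.

(** * The transfer operator on periodic functions *)

Lemma esumZl (R : realType) (T : choiceType) (D : set T) (c : R) (a : T -> \bar R) :
  0 < c -> (forall i, 0 <= a i)%E ->
  \esum_(i in D) (c%:E * a i)%E = (c%:E * \esum_(i in D) a i)%E.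
Proof.
move=> c0 a0; rewrite /esum -ereal_sup_pZl// image_comp; congr ereal_sup.
by apply: eq_imagel => F _; rewrite /= ge0_mule_fsumr.
Qed.

Section transfer_operator.
Variables (R : realType) (Q : int -> R).
Hypothesis Q_summable : summable [set: int] (fun i => (Q i)%:E).
Hypothesis Q_gt0 : forall i, 0 < Q i.
Hypothesis Q_even : forall i, Q (- i) = Q i.

Lemma Qq_esum (q : nat) (s : int) :
  (Qq Q q s)%:E = \esum_(l in [set l : int | (l = s %[mod q%:Z])%Z]) (Q l)%:E.
Proof.
have Q0 l : (0 <= (Q l)%:E)%E by rewrite lee_fin ltW.
rewrite fineK// ge0_fin_numE ?esum_ge0//; apply: le_lt_trans Q_summable.
rewrite esum_mkcond; apply: le_esum => l _; case: ifP => _; last exact: abse_ge0.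
by rewrite gee0_abs.
Qed.

Lemma Qq_gt0 (q : nat) (s : int) : 0 < Qq Q q s.
Proof.
rewrite -lte_fin Qq_esum; apply: (@lt_le_trans _ _ (Q s)%:E); first by rewrite lte_fin.
apply: esum_ge; exists [set s]; last by rewrite fsbig_set1.
by split=> // _ ->.
Qed.

Lemma Qq_opp (q : nat) (s : int) : Qq Q q (- s) = Qq Q q s.
Proof.
apply: EFin_inj; rewrite !Qq_esum.
rewrite (@reindex_esum _ _ _ [set l : int | (l = s %[mod q%:Z])%Z] _ -%R).
  by apply: eq_esum => l _; rewrite Q_even.
split.
- move=> l /= /eqP; rewrite eqz_mod_dvd => ls; apply/eqP.
  by rewrite eqz_mod_dvd -opprD rpredN.
- by move=> x y _ _ /oppr_inj.
- move=> l /= /eqP; rewrite eqz_mod_dvd => ls; exists (- l); last by rewrite opprK.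
  by apply/eqP; rewrite eqz_mod_dvd -[s]opprK -opprD rpredN.
Qed.

(** Sorting the summation index by its residue folds the sum over the integers
    onto one period, which is how the boundary law equation involves the same
    quantity as the denominator of [transition]. *)
Lemma periodic_convolution (q : nat) (lam : int -> R) (i : int) :
  (0 < q)%N -> (forall j, 0 < lam j) -> Defs.periodic q lam ->
  \esum_(j in [set: int]) (Q (i - j) * lam j)%:E =
  (\sum_(s < q) Qq Q q (i - s%:Z) * lam s%:Z)%:E.
Proof.
move=> q0 lam0 per.
have term0 j : (0 <= (Q (i - j) * lam j)%:E)%E by rewrite lee_fin ltW ?mulr_gt0.
pose class (s : 'I_q) : set int := [set j : int | (j = s%:Z %[mod q%:Z])%Z].
pose a j : \bar R := (Q (i - j) * lam j)%:E.
have -> : \esum_(j in [set: int]) a j =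
          \esum_(j in [set: int]) \sum_(s < q) (if j \in class s then a j else 0%E).
  apply: eq_esum => j _; rewrite (bigD1 (residue q0 j))// mem_set; last first.
    by rewrite /class /mkset residue_mod modz_mod.
  rewrite big1 => [|s sj]; first by rewrite /= adde0.
  rewrite memNset// => js.
  by rewrite (@residue_eq q q0 j s js) eqxx in sj.
rewrite esum_sum => [|j s _ _]; last by case: ifP => // _; exact: term0.
rewrite -sumEFin; apply: eq_bigr => s _; rewrite -esum_mkcond.
rewrite mulrC EFinM Qq_esum -esumZl//; last by move=> l; rewrite lee_fin ltW.
rewrite [RHS](@reindex_esum _ _ _ (class s) _ (fun j => i - j)).
  apply: eq_esum => j js.
  by rewrite /a (@periodic_mod q _ lam j s%:Z per js) EFinM muleC.
have classB x y : ((i - x = i - y %[mod q%:Z]) <-> (x = y %[mod q%:Z]))%Z.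
  split=> /eqP; rewrite eqz_mod_dvd => xy; apply/eqP; rewrite eqz_mod_dvd.
    by rewrite -rpredN (_ : - (x - y) = (i - x) - (i - y))//; ring.
  by rewrite -rpredN (_ : - (_ - _) = x - y)//; ring.
split.
- by move=> j /= /classB.
- by move=> x y _ _ /addrI/oppr_inj.
- move=> l /= ls; exists (i - l); last by rewrite opprB addrC subrK.
  by apply/classB; rewrite opprB addrC subrK.
Qed.

End transfer_operator.

Lemma eq_Qq (R : realType) (Q : int -> R) (q : nat) (s t : int) :
  (s = t %[mod q%:Z])%Z -> Qq Q q s = Qq Q q t.
Proof. by move=> st; rewrite /Qq; congr fine; congr esum; rewrite st. Qed.

(** The denominator of [transition]; for a boundary law it is, up to a constant,
    the [d]-th root of [lam]. *)
Definition fuzzy_norm (R : realType) (Q : int -> R) (q : nat) (lam : int -> R)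
  (i : int) : R := \sum_(s < q) Qq Q q (i - s%:Z) * lam s%:Z.

(** For a boundary law this is, up to a constant, [lam] to the power
    [(d - 1) / d]: the weight of an interior vertex of a path. *)
Definition law_ratio (R : realType) (Q : int -> R) (q : nat) (lam : int -> R)
  (i : int) : R := lam i / fuzzy_norm Q q lam i.

Lemma fuzzy_norm_gt0 (R : realType) (Q : int -> R) (q : nat) (lam : int -> R) (i : int) :
  summable [set: int] (fun i => (Q i)%:E) -> (forall i, 0 < Q i) ->
  (0 < q)%N -> (forall j, 0 < lam j) -> 0 < fuzzy_norm Q q lam i.
Proof.
move=> sumQ Q0 q0 lam0; rewrite /fuzzy_norm (bigD1 (Ordinal q0))//=.
rewrite ltr_wpDr ?mulr_gt0 ?Qq_gt0// sumr_ge0// => s _.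
by rewrite mulr_ge0 ?ltW ?Qq_gt0.
Qed.

Lemma eq_fuzzy_norm (R : realType) (Q : int -> R) (q : nat) (lam : int -> R) (i j : int) :
  (i = j %[mod q%:Z])%Z -> fuzzy_norm Q q lam i = fuzzy_norm Q q lam j.
Proof.
move=> ij; apply: eq_bigr => s _; congr (_ * _); apply: eq_Qq.
by apply/eqP; rewrite eqz_modDr; apply/eqP.
Qed.

(** * Marginals on a path *)

Section path_volume.
Variables (V : choiceType) (adj : rel V).
Hypothesis adj_sym : symmetric adj.
Hypothesis adj_acyclic : forall c : seq V, (2 < size c)%N -> ~ ucycle adj c.
Variables (x : V) (p : seq V).
Hypothesis path_p : path adj x p.
Hypothesis uniq_p : uniq (x :: p).

Definition path_volume : {fset V} := [fset y in x :: p]%fset.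

Lemma path_volumeE (y : V) : (y \in path_volume) = (y \in x :: p).
Proof. by rewrite in_fset. Qed.

Lemma path_root_subproof : x \in path_volume.
Proof. by rewrite path_volumeE mem_head. Qed.

Definition path_root : path_volume := [` path_root_subproof]%fset.

Definition path_vertex (i : nat) : path_volume :=
  insubd path_root (nth x (x :: p) i).

Lemma val_path_vertex (i : nat) :
  (i <= size p)%N -> val (path_vertex i) = nth x (x :: p) i.
Proof. by move=> ip; rewrite insubdK// unfold_in path_volumeE mem_nth. Qed.

Lemma path_vertex0 : path_vertex 0 = path_root.
Proof. by apply: val_inj; rewrite val_path_vertex. Qed.

Lemma path_vertexP (y : path_volume) :
  exists2 i, (i <= size p)%N & y = path_vertex i.
Proof.
have yp : val y \in x :: p by rewrite -path_volumeE (valP y).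
have ip : (index (val y) (x :: p) <= size p)%N by rewrite -index_mem in yp.
exists (index (val y) (x :: p)) => //.
by apply: val_inj; rewrite val_path_vertex ?nth_index.
Qed.

Lemma path_vertex_adj (i : nat) :
  (i < size p)%N -> adj (val (path_vertex i)) (val (path_vertex i.+1)).
Proof.
move=> ip; rewrite !val_path_vertex ?(ltnW ip)//.
exact: (pathP x path_p).
Qed.

Lemma path_volume_connected : connected_in adj path_volume.
Proof.
pose e := [rel u v : path_volume | adj (val u) (val v)].
have e_sym : connect_sym e by apply: sym_connect_sym => u v /=; rewrite adj_sym.
have root i : (i <= size p)%N -> connect e path_root (path_vertex i).
  elim: i => [|i IH] ip; first by rewrite path_vertex0 connect0.
  apply: connect_trans (IH (ltnW ip)) _.
  by apply: connect1; exact: path_vertex_adj.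
move=> y z; have [i ip ->] := path_vertexP y; have [j jp ->] := path_vertexP z.
by apply: connect_trans (root j jp); rewrite -/e e_sym root.
Qed.

Lemma prod_away_edges (R : comPzRingType) (f : path_volume -> path_volume -> R) :
  \prod_(e : path_volume * path_volume |
           `[< away_from adj (val path_root) (val e.1) (val e.2) >]) f e.1 e.2 =
  \prod_(i < size p) f (path_vertex i) (path_vertex i.+1).
Proof.
pose h (i : 'I_(size p)) := (path_vertex i, path_vertex i.+1).
have h_inj : injective h.
  move=> i j [/(congr1 val) + _]; rewrite !val_path_vertex ?(ltnW (ltn_ord _))//.
  move/eqP; rewrite nth_uniq ?ltnS ?(ltnW (ltn_ord _))// => /eqP ij.
  exact: val_inj.
transitivity (\prod_(e in [set h i | i in 'I_(size p)]%SET) f e.1 e.2); last first.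
  by rewrite big_imset//=; move=> i j _ _; exact: h_inj.
apply: eq_bigl => -[y z] /=.
have zp : val z \in x :: p by rewrite -path_volumeE (valP z).
apply/asboolP/imsetP.
  move/(away_from_path adj_sym adj_acyclic _ path_p uniq_p zp).
  move=> [i ip [yE zE]]; exists (Ordinal ip) => //.
  by congr pair; apply: val_inj; rewrite val_path_vertex// ltnW.
move=> [i _ [-> ->]].
apply/(away_from_path adj_sym adj_acyclic _ path_p uniq_p).
  by rewrite -path_volumeE (valP (path_vertex i.+1)).
by exists i => //; rewrite !val_path_vertex// ltnW.
Qed.

(** A fuzzy configuration contributes only if it agrees modulo [q] with the
    heights shifted by its value at the root.  The factors [Qq] from the
    transitions and from the increment law cancel by evenness. *)
Lemma path_marginal (R : realType) (d q : nat) (Q lam : int -> R)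
    (H : V -> int) (zeta : gradient adj) :
  summable [set: int] (fun i : int => (Q i)%:E) ->
  (forall i : int, 0 < Q i) -> (forall i : int, Q (- i) = Q i) ->
  (0 < q)%N -> Defs.periodic q lam ->
  H x = 0 -> (forall y z, adj y z -> zeta y z = H z - H y) ->
  gradient_marginal d Q q lam path_root zeta =
  (\prod_(i < size p) Q (H (nth x (x :: p) i.+1) - H (nth x (x :: p) i))) *
  \sum_(k < q) stationary d q lam k%:Z *
    \prod_(i < size p) (lam (k%:Z + H (nth x (x :: p) i.+1)) /
                        fuzzy_norm Q q lam (k%:Z + H (nth x (x :: p) i))).
Proof.
move=> Q_sum Q_gt0 Q_even q_gt0 lam_per Hx zetaE.
pose G (k : 'I_q) : {ffun path_volume -> 'I_q} :=
  [ffun y => residue q_gt0 (k%:Z + H (val y))].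
have Groot k : G k path_root = k by rewrite ffunE Hx addr0 residue_id.
have G_inj : injective G by move=> j k jk; rewrite -(Groot j) jk Groot.
have Gmod k y : ((G k y)%:Z = k%:Z + H (val y) %[mod q%:Z])%Z.
  by rewrite ffunE residue_mod modz_mod.
rewrite /gradient_marginal /fuzzy_marginal.
under eq_bigr => sigma _.
  rewrite (prod_away_edges (fun a b => transition Q q lam (sigma a)%:Z (sigma b)%:Z)).
  rewrite (prod_away_edges (fun a b => increment_law Q q (zeta (val a) (val b))
     ((sigma b)%:Z - (sigma a)%:Z))).
  over.
(* An edge on which [sigma] violates the heights contributes a factor 0, so the
   sum is carried by the image of [G]. *)
rewrite (bigID (mem [set G k | k in 'I_q]%SET)) /= [X in _ + X]big1 ?addr0; last first.
  move=> sigma sG.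
  have [/forallP compat|] := boolP [forall i : 'I_(size p),
      (zeta (val (path_vertex i)) (val (path_vertex i.+1)) ==
       (sigma (path_vertex i.+1))%:Z - (sigma (path_vertex i))%:Z %[mod q%:Z])%Z].
    case/negP: sG; apply/imsetP; exists (sigma path_root) => //.
    apply/ffunP => y; have [i ip ->] := path_vertexP y; rewrite ffunE.
    apply/esym/residue_eq; elim: i ip {y} => [|i IH] ip.
      by rewrite path_vertex0 Hx addr0.
    have := compat (Ordinal ip); rewrite zetaE ?path_vertex_adj//= => /eqP.
    have /eqP := IH (ltnW ip); rewrite eqz_mod_dvd => IHi.
    move/eqP; rewrite eqz_mod_dvd => step; apply/eqP; rewrite eqz_mod_dvd.
    by have := rpredD IHi step; congr (_ %| _)%Z; ring.
  rewrite negb_forall => /existsP[i /negPf ni].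
  by rewrite [X in _ * X](bigD1 i)//= /increment_law ni mul0r mulr0.
rewrite big_imset/=; last by move=> j k _ _; exact: G_inj.
rewrite mulr_sumr; apply: eq_bigr => k _.
rewrite Groot; move: (stationary _ _ _ _) => al.
rewrite [RHS]mulrCA -!mulrA -!big_split /=; congr (al * _).
apply: eq_bigr => i _.
have -> : nth x p i = val (path_vertex i.+1) by rewrite val_path_vertex.
have -> : nth x (x :: p) i = val (path_vertex i).
  by rewrite val_path_vertex// ltnW.
have := path_vertex_adj (ltn_ord i).
move: (path_vertex i) (path_vertex i.+1) => y z yz; rewrite zetaE//.
rewrite /increment_law ifT; last first.
  rewrite eqz_mod_dvd; have /eqP := Gmod k y; have /eqP := Gmod k z.
  rewrite !eqz_mod_dvd => zk /(rpredB zk); rewrite -rpredN.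
  by congr (_ %| _)%Z; ring.
rewrite /transition -/(fuzzy_norm _ _ _ _) (eq_fuzzy_norm _ _ (Gmod k y)).
rewrite (periodic_mod lam_per (Gmod k z)) 
  -(Qq_opp Q_sum Q_gt0 Q_even q ((G k z)%:Z - (G k y)%:Z)) opprB.
have Qq_neq0 := lt0r_neq0 (Qq_gt0 Q_sum Q_gt0 q ((G k y)%:Z - (G k z)%:Z)).
set S := fuzzy_norm _ _ _ _; set t := Qq _ _ _ in Qq_neq0 *.
set l := lam _; set u := Q _.
by transitivity (u * (l / S) * (t / t)); [ring|rewrite divff// mulr1].
Qed.

End path_volume.
(** * Prescribed heights along a path *)

Lemma measurable_cylinder (V : choiceType) (adj : rel V) (L : {fset V})
    (zeta : gradient adj) :
  measurable [set eta : gradient_space adj | forall x y : L,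
    adj (val x) (val y) -> (eta : gradient adj) (val x) (val y) = zeta (val x) (val y)].
Proof.
rewrite [X in measurable X](_ : _ = \bigcap_(e in [set: L * L])
   [set eta : gradient_space adj | adj (val e.1) (val e.2) ->
     (eta : gradient adj) (val e.1) (val e.2) = zeta (val e.1) (val e.2)]).
  apply: fin_bigcap_measurable => // -[x y] _ /=.
  have [xy|nxy] := boolP (adj (val x) (val y)); last first.
    by rewrite [X in measurable X](_ : _ = setT)//; apply/seteqP; split.
  apply: sub_sigma_algebra; exists (val x), (val y), (zeta (val x) (val y)).
  by split=> //; apply/seteqP; split=> eta /=; [exact|move=> ? _].
apply/seteqP; split=> eta /= Heta; first by move=> [x y] _; exact: Heta.
by move=> x y; exact: (Heta (x, y)).
Qed.

Lemma height_gradient (V : choiceType) (adj : rel V) (H : V -> int) :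
  symmetric adj ->
  exists zeta : gradient adj, forall y z, adj y z -> zeta y z = H z - H y.
Proof.
move=> adj_sym; pose f y z := if adj y z then H z - H y else 0.
have f_anti y z : f y z = - f z y.
  by rewrite /f adj_sym; case: ifP => _; rewrite ?opprB ?oppr0.
have f_off y z : ~~ adj y z -> f y z = 0 by rewrite /f => /negPf ->.
by exists (Gradient f_anti f_off) => y z yz; rewrite /= /f yz.
Qed.

(** Shifting the denominators by one vertex: the numerator at a vertex comes from
    the edge that enters it, the denominator from the edge that leaves it. *)
Lemma prod_path_factors (R : fieldType) (l s : int -> R) (a b : int) (hs : seq int) :
  \prod_(i < (size hs).+1)
     (l (nth 0 (rcons hs b) i) / s (nth 0 (a :: rcons hs b) i)) =
  l b / s a * \prod_(h <- hs) (l h / s h).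
Proof.
elim: hs a => [|h hs IH] a; first by rewrite big_ord1 big_nil mulr1.
rewrite big_ord_recl big_cons/=.
under eq_bigr do rewrite !add0n.
by rewrite IH; ring.
Qed.

Section height_law.
Variables (R : realType) (d q : nat) (Q lam : int -> R).
Hypothesis Q_summable : summable [set: int] (fun i => (Q i)%:E).
Hypothesis Q_gt0 : forall i, 0 < Q i.
Hypothesis Q_even : forall i, Q (- i) = Q i.
Hypothesis lam_law : periodic_boundary_law d Q q lam.

Lemma stationary_gt0 (i : int) : 0 < stationary d q lam i.
Proof.
have [q0 lam0 _ _] := lam_law.
rewrite divr_gt0 ?powR_gt0// (bigD1 (Ordinal q0))//= ltr_wpDr ?powR_gt0//.
by apply: sumr_ge0 => j _; exact: powR_ge0.
Qed.

Lemma law_ratio_gt0 (i : int) : 0 < law_ratio Q q lam i.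
Proof.
by have [q0 lam0 _ _] := lam_law; rewrite divr_gt0// fuzzy_norm_gt0.
Qed.

(** Raising [lam / S] to the power [d] and replacing [S ^+ d] by [lam / c] avoids
    fractional powers. *)
Lemma law_ratioX : (0 < d)%N ->
  exists2 c : R, 0 < c & forall i, law_ratio Q q lam i ^+ d = c * lam i ^+ d.-1.
Proof.
have [q0 lam0 per [c c0 eqn]] := lam_law.
move=> d0; exists c => // i; have := eqn i.
rewrite (periodic_convolution Q_summable Q_gt0 i q0 lam0 per).
rewrite -/(fuzzy_norm Q q lam i) -EFin_expe -EFinM => -[lamE].
have S0 := lt0r_neq0 (fuzzy_norm_gt0 i Q_summable Q_gt0 q0 lam0).
have lamX : lam i ^+ d = lam i * lam i ^+ d.-1 by rewrite -exprS prednK.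
by rewrite exprMn exprVn lamX {1}lamE mulrAC mulfK ?expf_neq0.
Qed.

(** The interior heights [hs] are arbitrary and the two endpoints have height 0,
    so that the remaining factors depend on [k] alone and can be absorbed in the
    weight. *)
Lemma height_path_marginal (V : choiceType) (adj : rel V) (x : V) (p : seq V)
    (hs : seq int) (zeta : gradient adj) :
  symmetric adj -> (forall c : seq V, (2 < size c)%N -> ~ ucycle adj c) ->
  path adj x p -> uniq (x :: p) -> size p = (size hs).+1 ->
  (forall y z, adj y z -> zeta y z =
     nth 0 (0 :: rcons hs 0) (index z (x :: p)) -
     nth 0 (0 :: rcons hs 0) (index y (x :: p))) ->
  gradient_marginal d Q q lam (path_root x p) zeta =
  (\prod_(i < size p) Q (nth 0 (rcons hs 0) i - nth 0 (0 :: rcons hs 0) i)) *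
  \sum_(k < q) (stationary d q lam k%:Z * law_ratio Q q lam k%:Z) *
     \prod_(h <- hs) law_ratio Q q lam (k%:Z + h).
Proof.
move=> adj_sym acy pxp uxp sp zetaE.
have [q0 _ per _] := lam_law.
rewrite (path_marginal adj_sym acy pxp uxp d Q_summable Q_gt0 Q_even q0 per _ zetaE);
  last by rewrite /= eqxx.
have HE i : (i <= size p)%N -> index (nth x (x :: p) i) (x :: p) = i.
  by move=> ip; rewrite index_uniq.
congr (_ * _).
  by apply: eq_bigr => i _; rewrite !HE// ltnW.
apply: eq_bigr => k _; rewrite -mulrA; congr (_ * _).
transitivity (\prod_(i < (size hs).+1) (lam (k%:Z + nth 0 (rcons hs 0) i) /
    fuzzy_norm Q q lam (k%:Z + nth 0 (0 :: rcons hs 0) i))).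
  by rewrite -sp; apply: eq_bigr => i _; rewrite !HE// ltnW.
rewrite (prod_path_factors (fun h => lam (k%:Z + h))
  (fun h => fuzzy_norm Q q lam (k%:Z + h))).
by rewrite !addr0.
Qed.

End height_law.

(** * Identification of the boundary law *)

Theorem theorem5 (R : realType) (d : nat) (V : choiceType) (adj : rel V)
    (Q : int -> R) (q1 q2 : nat) (lam1 lam2 : int -> R)
    (nu1 nu2 : probability (gradient_space adj) R) :
  (2 <= d)%N ->
  cayley_tree d adj ->
  summable [set: int] (fun i : int => (Q i)%:E) ->
  (forall i : int, 0 < Q i) ->
  (forall i : int, Q (- i) = Q i) ->
  periodic_boundary_law d Q q1 lam1 -> minimal_period q1 lam1 ->
  periodic_boundary_law d Q q2 lam2 -> minimal_period q2 lam2 ->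
  gradient_gibbs_measure d Q q1 lam1 nu1 ->
  gradient_gibbs_measure d Q q2 lam2 nu2 ->
  (forall A : set (gradient_space adj), measurable A -> nu1 A = nu2 A) ->
  q1 = q2 /\
  exists (a : int) (c : R), 0 < c /\
    forall k : int, lam2 k = c * lam1 (k + a).
Proof.
move=> d2 tree Q_sum Q_gt0 Q_even law1 min1 law2 min2 gibbs1 gibbs2 nuE.
have d0 : (0 < d)%N by exact: ltnW.
have [_ [adj_sym _] _ acy _] := tree.
have moments (hs : seq int) :
    \sum_(k < q1) (stationary d q1 lam1 k%:Z * law_ratio Q q1 lam1 k%:Z) *
      \prod_(h <- hs) law_ratio Q q1 lam1 (k%:Z + h) =
    \sum_(k < q2) (stationary d q2 lam2 k%:Z * law_ratio Q q2 lam2 k%:Z) *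
      \prod_(h <- hs) law_ratio Q q2 lam2 (k%:Z + h).
  have [x [p [pxp uxp sp]]] := tree_has_long_path (size hs).+1 d0 tree.
  have [zeta zetaE] := height_gradient
    (fun y => nth 0 (0 :: rcons hs 0) (index y (x :: p))) adj_sym.
  have conn := path_volume_connected adj_sym pxp.
  have := nuE _ (measurable_cylinder (path_volume x p) zeta).
  rewrite (gibbs1 _ (path_root x p) _ conn) (gibbs2 _ (path_root x p) _ conn).
  move=> [].
  rewrite (height_path_marginal Q_sum Q_gt0 Q_even law1 adj_sym acy pxp uxp sp zetaE).
  rewrite (height_path_marginal Q_sum Q_gt0 Q_even law2 adj_sym acy pxp uxp sp zetaE).
  apply: mulfI; rewrite prodf_seq_neq0; apply/allP => i _ /=.
  by rewrite gt_eqF.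
have [[q1_gt0 lam1_gt0 per1 _] [q2_gt0 lam2_gt0 per2 _]] := (law1, law2).
have weight_gt0 (k : 'I_q2) :
    0 < stationary d q2 lam2 k%:Z * law_ratio Q q2 lam2 k%:Z.
  exact: mulr_gt0 (stationary_gt0 law2 _) (law_ratio_gt0 Q_sum Q_gt0 law2 _).
have [a aE] := moments_determine_points weight_gt0 moments (Ordinal q2_gt0).
have {}aE k : law_ratio Q q1 lam1 (k + a%:Z) = law_ratio Q q2 lam2 k.
  by rewrite addrC aE add0r.
have [c1 c1_gt0 ratio1] := law_ratioX Q_sum Q_gt0 law1 d0.
have [c2 c2_gt0 ratio2] := law_ratioX Q_sum Q_gt0 law2 d0.
have powE k : (lam2 k / lam1 (k + a%:Z)) ^+ d.-1 = c1 / c2.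
  rewrite exprMn exprVn; apply/eqP; rewrite eqr_div ?lt0r_neq0 ?exprn_gt0//.
  by rewrite mulrC -ratio2 -aE ratio1.
have ratio_gt0 k : 0 < lam2 k / lam1 (k + a%:Z) by rewrite divr_gt0.
have lam2E k : lam2 k = lam2 0 / lam1 (0 + a%:Z) * lam1 (k + a%:Z).
  suff <- : lam2 k / lam1 (k + a%:Z) = lam2 0 / lam1 (0 + a%:Z).
    by rewrite divfK ?lt0r_neq0.
  apply: (@pexpIrn _ d.-1); rewrite ?nnegrE ?ltW//; last by rewrite !powE.
  by rewrite -ltnS prednK.
have [_ _ qmin1] := min1; have [_ _ qmin2] := min2.
split; last by exists a%:Z, (lam2 0 / lam1 (0 + a%:Z)).
apply/eqP; rewrite eqn_leq; apply/andP; split.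
  apply: qmin1 => // i; apply: (mulfI (lt0r_neq0 (ratio_gt0 0))).
  by rewrite -{1}(subrK a%:Z i) addrAC -lam2E per2 lam2E subrK.
apply: qmin2 => // i.
by rewrite lam2E addrAC per1 -lam2E.
Qed.
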